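(* Let $\Phi = F/F^{(2)}$ be the free metabelian group on two generators, where $F$ is the free group on two generators and $F^{(2)} = [[F,F],[F,F]]$. Then $\Phi$ does not have the Congruence Subgroup Property.
   Context: For a finitely generated group $G$ and a characteristic subgroup $K$ of finite index in $G$, set $\Gamma[K] := \ker(\mathrm{Aut}(G) \to \mathrm{Aut}(G/K))$. The group $G$ has the Congruence Subgroup Property (CSP) if every finite index subgroup of $\mathrm{Aut}(G)$ contains $\Gamma[K]$ for some characteristic subgroup $K$ of finite index in $G$. *)

(* Defs.v *)
From HB Require Import structures.
From mathcomp Require Import all_boot.
From mathcomp Require Import boolp classical_sets functions cardinality.

Set Implicit Arguments.
Unset Strict Implicit.
Unset Printing Implicit Defensive.

Local Open Scope classical_set_scope.
Local Open Scope group_scope.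
Local Open Scope quotient_scope.

Section Subgroups.
Variable G : groupType.
Implicit Types (S H K : set G).

Definition is_subgroup H := H 1 /\ (forall x y, H x -> H y -> H (x / y)).

Definition is_normal H := is_subgroup H /\ (forall x y, H x -> H (x ^ y)).

Definition generated S : set G :=
  [set x | forall H, is_subgroup H -> S `<=` H -> H x].

Definition finitely_generated := exists2 S, finite_set S & generated S = setT.

Definition left_coset H (x : G) : set G := [set y | H (x^-1 * y)].

Definition finite_index H := finite_set (range (left_coset H)).

Definition commutator_subgroup H K : set G :=
  generated [set z | exists x y, [/\ H x, K y & z = [~ x, y]]].

Fixpoint derived_subgroup (n : nat) : set G :=
  if n is m.+1 then
    commutator_subgroup (derived_subgroup m) (derived_subgroup m)
  else setT.

Lemma subgroupV H x : is_subgroup H -> H x -> H x^-1.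
Proof. by move=> [H1 HF] Hx; rewrite -[x^-1]mul1g; apply: HF. Qed.

Lemma subgroupM H x y : is_subgroup H -> H x -> H y -> H (x * y).
Proof.
move=> gH Hx Hy; rewrite -[y]invgK; apply: gH.2 => //; exact: subgroupV.
Qed.

Lemma generated_subgroup S : is_subgroup (generated S).
Proof.
split=> [H [] //|x y Sx Sy H gH SH].
by apply: gH.2; [apply: Sx | apply: Sy].
Qed.

Lemma sub_generated S : S `<=` generated S.
Proof. by move=> x Sx H _; apply. Qed.

Lemma generated_normal S :
  (forall x y, S x -> S (x ^ y)) -> is_normal (generated S).
Proof.
move=> SJ; split=> [|x y Sx H gH SH]; first exact: generated_subgroup.
apply: (Sx [set z | H (z ^ y)]) => [|z Sz]; last by apply: SH; apply: SJ.
split=> /= [|u v Hu Hv]; first by rewrite conj1g; exact: gH.1.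
by rewrite conjMg conjVg; apply: gH.2.
Qed.

Lemma derived_normal n : is_normal (derived_subgroup n).
Proof.
elim: n => [|n [_ IHn]] //=; apply: generated_normal => _ z [x [y [Hx Hy ->]]].
by exists (x ^ z), (y ^ z); rewrite conjRg; split=> //; apply: IHn.
Qed.

End Subgroups.

Record normalSubgroup (G : groupType) := NormalSubgroup {
  normal_set :> set G;
  normal_setP : is_normal normal_set }.

Lemma morph_monoid (G H : groupType) (f : G -> H) :
  {morph f : x y / x * y} -> monoid_morphism f.
Proof.
by move=> fM; split=> //; apply: (@mulgI _ (f 1)); rewrite -fM !mulg1.
Qed.

Section Quotient.
Variables (G : groupType) (N : normalSubgroup G).

Let gN : is_subgroup N := (normal_setP N).1.

Definition coset_rel (x y : G) : bool := `[< normal_set N (x^-1 * y) >].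

Lemma coset_rel_equiv : equiv_class_of coset_rel.
Proof.
split=> [x|x y|y x z].
- by apply/asboolP; rewrite mulVg; exact: gN.1.
- by apply/asboolP/asboolP => /(subgroupV gN); rewrite invgM invgK.
- move=> /asboolP Nxy /asboolP Nyz; apply/asboolP.
  by have := subgroupM gN Nxy Nyz; rewrite mulgA mulgK.
Qed.

Canonical coset_rel_equiv_rel := EquivRelPack coset_rel_equiv.

Definition quotient_group := {eq_quot coset_rel}.
HB.instance Definition _ := Choice.on quotient_group.
HB.instance Definition _ := EqQuotient.on quotient_group.

Definition coset (x : G) : quotient_group := \pi_quotient_group x.

Lemma coset_eqP x y : coset x = coset y <-> normal_set N (x^-1 * y).
Proof.
by split=> [/eqmodP/asboolP | Nxy]; last by apply/eqmodP/asboolP.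
Qed.

Lemma coset_repr (u : quotient_group) : coset (repr u) = u.
Proof. exact: reprK. Qed.

Definition quotient_one : quotient_group := coset 1.
Definition quotient_inv (u : quotient_group) := coset (repr u)^-1.
Definition quotient_mul (u v : quotient_group) := coset (repr u * repr v).

Lemma coset_mul x y : quotient_mul (coset x) (coset y) = coset (x * y).
Proof.
apply/coset_eqP; set a := repr _; set b := repr _.
have Na : normal_set N (a^-1 * x) by apply/coset_eqP; rewrite coset_repr.
have Nb : normal_set N (b^-1 * y) by apply/coset_eqP; rewrite coset_repr.
have := subgroupM gN ((normal_setP N).2 _ b Na) Nb.
by rewrite conjgE invgM !mulgA mulgK.
Qed.

Lemma coset_inv x : quotient_inv (coset x) = coset x^-1.
Proof.
apply/coset_eqP; set a := repr _; rewrite invgK.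
have Na : normal_set N (x^-1 * a) by apply/coset_eqP; rewrite coset_repr.
by have := (normal_setP N).2 _ x^-1 Na; rewrite conjgE invgK !mulgA mulgV mul1g.
Qed.

Lemma quotient_mulA : associative quotient_mul.
Proof.
move=> u v w; rewrite -(coset_repr u) -(coset_repr v) -(coset_repr w).
by rewrite !coset_mul mulgA.
Qed.
Lemma quotient_1mul : left_id quotient_one quotient_mul.
Proof. by move=> u; rewrite -(coset_repr u) coset_mul mul1g. Qed.
Lemma quotient_mul1 : right_id quotient_one quotient_mul.
Proof. by move=> u; rewrite -(coset_repr u) coset_mul mulg1. Qed.
Lemma quotient_Vmul : left_inverse quotient_one quotient_inv quotient_mul.
Proof. by move=> u; rewrite -(coset_repr u) coset_inv coset_mul mulVg. Qed.
Lemma quotient_mulV : right_inverse quotient_one quotient_inv quotient_mul.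
Proof. by move=> u; rewrite -(coset_repr u) coset_inv coset_mul mulgV. Qed.

HB.instance Definition _ := isGroup.Build quotient_group
  quotient_mulA quotient_1mul quotient_mul1 quotient_Vmul quotient_mulV.

Lemma cosetM : {morph coset : x y / x * y}.
Proof. by move=> x y; rewrite -coset_mul. Qed.

HB.instance Definition _ := isUMagmaMorphism.Build G quotient_group coset
  (morph_monoid cosetM).

End Quotient.

Record aut (G : groupType) := Aut {
  aut_fun :> G -> G;
  autM : {morph aut_fun : x y / x * y};
  aut_bij : bijective aut_fun }.

HB.instance Definition _ (G : groupType) := gen_eqMixin (aut G).
HB.instance Definition _ (G : groupType) := gen_choiceMixin (aut G).

Section AutGroup.
Variable G : groupType.
Implicit Types f g : aut G.

Lemma autP f g : f =1 g -> f = g.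
Proof.
case: f g => [f fM fB] [g gM gB] /= /funext efg; rewrite -efg in gM gB *.
by rewrite (Prop_irrelevance fM gM) (Prop_irrelevance fB gB).
Qed.

HB.instance Definition _ f := isUMagmaMorphism.Build G G f (morph_monoid (@autM G f)).

Lemma aut_inv_subproof f : exists g : G -> G, cancel f g /\ cancel g f.
Proof. by case: (aut_bij f) => g fK gK; exists g. Qed.

Definition aut_inv_fun f : G -> G := projT1 (cid (aut_inv_subproof f)).

Lemma aut_funK f : cancel f (aut_inv_fun f).
Proof. exact: (projT2 (cid (aut_inv_subproof f))).1. Qed.
Lemma aut_inv_funK f : cancel (aut_inv_fun f) f.
Proof. exact: (projT2 (cid (aut_inv_subproof f))).2. Qed.

Lemma aut_inv_funM f : {morph aut_inv_fun f : x y / x * y}.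
Proof. exact: can2_gmulfM (aut_funK f) (aut_inv_funK f). Qed.

Lemma aut_compM f g : {morph f \o g : x y / x * y}.
Proof. by move=> x y /=; rewrite !autM. Qed.

Definition aut_one : aut G := @Aut G idfun (fun _ _ => erefl) (inv_bij (frefl _)).
Definition aut_inv f : aut G :=
  Aut (@aut_inv_funM f) (Bijective (aut_inv_funK f) (aut_funK f)).
Definition aut_mul f g : aut G :=
  Aut (@aut_compM f g) (bij_comp (aut_bij f) (aut_bij g)).

Lemma aut_mulA : associative aut_mul. Proof. by move=> f g h; apply: autP. Qed.
Lemma aut_1mul : left_id aut_one aut_mul. Proof. by move=> f; apply: autP. Qed.
Lemma aut_mul1 : right_id aut_one aut_mul. Proof. by move=> f; apply: autP. Qed.
Lemma aut_Vmul : left_inverse aut_one aut_inv aut_mul.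
Proof. by move=> f; apply: autP => x /=; rewrite aut_funK. Qed.
Lemma aut_mulV : right_inverse aut_one aut_inv aut_mul.
Proof. by move=> f; apply: autP => x /=; rewrite aut_inv_funK. Qed.

HB.instance Definition _ := isGroup.Build (aut G)
  aut_mulA aut_1mul aut_mul1 aut_Vmul aut_mulV.

Definition is_characteristic (K : set G) :=
  is_subgroup K /\ (forall f : aut G, f @` K = K).

Lemma characteristic_normal (K : set G) : is_characteristic K -> is_normal K.
Proof.
move=> [gK cK]; split=> // x y Kx.
have cjM : {morph (conjg (G := G))^~ y : u v / u * v}.
  by move=> u v; exact: conjMg.
have cjB : bijective ((conjg (G := G))^~ y).
  by exists ((conjg (G := G))^~ y^-1) => z; rewrite ?conjgK ?conjgKV.
by rewrite -(cK (Aut cjM cjB)); exists x.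
Qed.

End AutGroup.

Record charSubgroup (G : groupType) := CharSubgroup {
  char_set : set G;
  char_setP : is_characteristic char_set }.

Coercion char_normal (G : groupType) (K : charSubgroup G) : normalSubgroup G :=
  NormalSubgroup (characteristic_normal (char_setP K)).

Definition kernel (G H : groupType) (f : G -> H) : set G := [set x | f x = 1].

Section Congruence.
Variables (G : groupType) (K : charSubgroup G).

Definition induced_fun (f : aut G) (u : quotient_group K) : quotient_group K :=
  coset K (f (repr u)).

Lemma induced_coset f x : induced_fun f (coset K x) = coset K (f x).
Proof.
apply/coset_eqP; rewrite -gmulfV -autM.
suff Kr : normal_set K ((repr (coset K x))^-1 * x).
  by rewrite /= -((char_setP K).2 f); exists ((repr (coset K x))^-1 * x).
by apply/coset_eqP; rewrite coset_repr.
Qed.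

Lemma induced_funM f : {morph induced_fun f : u v / u * v}.
Proof.
move=> u v; rewrite -(coset_repr u) -(coset_repr v) -cosetM !induced_coset.
by rewrite autM cosetM.
Qed.

Lemma induced_fun_bij f : bijective (induced_fun f).
Proof.
exists (induced_fun f^-1) => u; rewrite -(coset_repr u) !induced_coset.
  by congr coset; exact: aut_funK.
by congr coset; exact: aut_inv_funK.
Qed.

Definition induced (f : aut G) : aut (quotient_group K) :=
  Aut (@induced_funM f) (induced_fun_bij f).

Lemma inducedM : {morph induced : f g / f * g}.
Proof.
by move=> f g; apply: autP => u; rewrite -(coset_repr u) /= !induced_coset.
Qed.

HB.instance Definition _ :=
  isUMagmaMorphism.Build (aut G) (aut (quotient_group K)) induced
    (morph_monoid inducedM).

(* Gamma[K] = ker (Aut G -> Aut (G / K)). *)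
Definition congruence_subgroup : set (aut G) := kernel induced.

End Congruence.

(* Meant for finitely generated G, as is free_metabelian X for X finite
   (free_metabelian_fg below). *)
Definition has_CSP (G : groupType) :=
  forall H : set (aut G), is_subgroup H -> finite_index H ->
    exists K : charSubgroup G,
      finite_index K /\ congruence_subgroup K `<=` H.

(* Free groups as reduced words: the letter (x, true) stands for x and
   (x, false) for its inverse. *)
Section FreeGroup.
Variable X : choiceType.
Implicit Types (a b : X * bool) (s t w : seq (X * bool)).

Definition inv_letter a := (a.1, ~~ a.2).

Definition reduced w := sorted (fun a b => b != inv_letter a) w.

Record free_group := FreeGroup { fg_word :> seq (X * bool); _ : reduced fg_word }.
HB.instance Definition _ := [isSub for fg_word].
HB.instance Definition _ := [Choice of free_group by <:].

Definition push a w :=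
  if w is b :: w' then if b == inv_letter a then w' else a :: w else [:: a].

(* The reduced form of s ++ w, for w reduced. *)
Definition reduce_cat s w := foldr push w s.

Definition inv_word w := rev (map inv_letter w).

Lemma inv_letterK : involutive inv_letter.
Proof. by case=> x e; rewrite /inv_letter /= negbK. Qed.

Lemma inv_letter_neq a : (a == inv_letter a) = false.
Proof. by case: a => x []; rewrite /inv_letter xpair_eqE eqxx. Qed.

Lemma reduced_push a w : reduced w -> reduced (push a w).
Proof.
case: w => [|b w] //= rw; case: eqP => [_|/eqP nab]; first exact: path_sorted rw.
by rewrite /reduced /= nab.
Qed.

Lemma reduced_reduce_cat s w : reduced w -> reduced (reduce_cat s w).
Proof. by move=> rw; elim: s => //= a s; apply: reduced_push. Qed.

Lemma pushK a w : reduced w -> push (inv_letter a) (push a w) = w.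
Proof.
case: w => [|b w] /=; first by rewrite inv_letterK eqxx.
case: eqP => [->|_]; last by rewrite /= inv_letterK eqxx.
by case: w => [|c w] //= /andP[/negPf-> _].
Qed.

Lemma pushVK a w : reduced w -> push a (push (inv_letter a) w) = w.
Proof. by move=> rw; rewrite -{1}[a]inv_letterK pushK. Qed.

Lemma reduce_cat_push a w t :
  reduced t -> reduce_cat (push a w) t = push a (reduce_cat w t).
Proof.
move=> rt; case: w => [|b w] //=; case: eqP => [->|_] //=.
by rewrite pushVK //; apply: reduced_reduce_cat.
Qed.

Lemma reduce_catA s w t : reduced t ->
  reduce_cat s (reduce_cat w t) = reduce_cat (reduce_cat s w) t.
Proof. by move=> rt; elim: s => //= a s ->; rewrite reduce_cat_push. Qed.

Lemma reduce_cat0 w : reduced w -> reduce_cat w [::] = w.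
Proof.
elim: w => //= a w IHw rw; rewrite IHw; last exact: path_sorted rw.
by case: w rw {IHw} => //= b w /andP[/negPf-> _].
Qed.

Lemma reduced_inv_word w : reduced w -> reduced (inv_word w).
Proof.
rewrite /reduced rev_sorted sorted_map; apply: sub_sorted => a b /=.
by rewrite inv_letterK; apply: contraNneq => ->.
Qed.

Lemma inv_wordK : involutive inv_word.
Proof.
move=> w; rewrite /inv_word map_rev revK -map_comp map_id_in // => a _ /=.
exact: inv_letterK.
Qed.

Lemma reduce_inv_wordK w t :
  reduced t -> reduce_cat (inv_word w) (reduce_cat w t) = t.
Proof.
move=> rt; elim: w => //= a w IHw; rewrite /inv_word /= rev_cons.
rewrite /reduce_cat foldr_rcons pushK ?IHw //.
exact: reduced_reduce_cat.
Qed.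

Definition fg_one := @FreeGroup [::] isT.
Definition fg_inv (u : free_group) := FreeGroup (reduced_inv_word (valP u)).
Definition fg_mul (u v : free_group) :=
  FreeGroup (reduced_reduce_cat u (valP v)).

Lemma fg_mulA : associative fg_mul.
Proof.
by move=> u v w; apply/val_inj; rewrite /= reduce_catA //; exact: (valP w).
Qed.
Lemma fg_1mul : left_id fg_one fg_mul.
Proof. by move=> u; apply/val_inj. Qed.
Lemma fg_mul1 : right_id fg_one fg_mul.
Proof. by move=> u; apply/val_inj; rewrite /= reduce_cat0 //; exact: (valP u). Qed.
Lemma fg_Vmul : left_inverse fg_one fg_inv fg_mul.
Proof.
move=> u; apply/val_inj => /=.
by rewrite -{2}(reduce_cat0 (valP u)) reduce_inv_wordK.
Qed.
Lemma fg_mulV : right_inverse fg_one fg_inv fg_mul.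
Proof.
move=> u; apply/val_inj => /=; rewrite -{1}[fg_word u]inv_wordK.
by rewrite -{2}(reduce_cat0 (reduced_inv_word (valP u))) reduce_inv_wordK.
Qed.

HB.instance Definition _ := isGroup.Build free_group
  fg_mulA fg_1mul fg_mul1 fg_Vmul fg_mulV.

Lemma fg_wordP (u v : free_group) : fg_word u = fg_word v -> u = v.
Proof. exact: val_inj. Qed.

Definition fg_gen (x : X) : free_group := @FreeGroup [:: (x, true)] isT.

Lemma fg_gen_ind (H : set free_group) :
  is_subgroup H -> (forall x, H (fg_gen x)) -> H = setT.
Proof.
move=> gH Hx; apply/seteqP; split=> // -[w rw] _.
elim: w rw => [|a w IHw] rw.
  have -> : FreeGroup rw = 1 by apply: fg_wordP.
  exact: gH.1.
have rw' : reduced w by exact: path_sorted rw.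
pose l := @FreeGroup [:: a] isT.
have -> : FreeGroup rw = l * FreeGroup rw'.
  by apply: fg_wordP => /=; case: w rw {IHw rw'} => //= b w /andP[/negPf-> _].
apply: subgroupM => //.
rewrite {}/l; case: a {rw} => x []; first exact: Hx.
by have := subgroupV gH (Hx x); congr (H _); apply: fg_wordP.
Qed.

Lemma free_group_universal (G : groupType) (g : X -> G) :
  exists2 f : free_group -> G,
    {morph f : u v / u * v} /\ (forall x, f (fg_gen x) = g x)
  & forall f' : free_group -> G, {morph f' : u v / u * v} ->
      (forall x, f' (fg_gen x) = g x) -> f' =1 f.
Proof.
pose gl a := if a.2 then g a.1 else (g a.1)^-1.
pose ev w := foldr (fun a z => gl a * z) 1 w.
have glV a : gl (inv_letter a) = (gl a)^-1.
  by case: a => x []; rewrite /gl //= invgK.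
have ev_push a w : ev (push a w) = gl a * ev w.
  by case: w => //= b w; case: eqP => [->|] //; rewrite glV mulgA mulgV mul1g.
have evM (v w : free_group) : ev (v * w) = ev v * ev w.
  rewrite /= /reduce_cat; elim: (fg_word v) => /= [|a s IHs].
    by rewrite mul1g.
  by rewrite ev_push IHs mulgA.
have ev_gen x : ev (fg_gen x) = g x by rewrite /ev /= mulg1.
exists (fun u => ev u) => [//|f' f'M f'g u].
have morphV (f : free_group -> G) : {morph f : v w / v * w} ->
    forall v, f v^-1 = (f v)^-1.
  move=> fM v; apply: (@mulgI _ (f v)).
  by rewrite -fM !mulgV (morph_monoid fM).1.
suff /seteqP[_ /(_ u)]: [set v | f' v = ev v] = setT by apply.
apply: fg_gen_ind => [|x] /=; last exact: etrans (f'g x) (esym (ev_gen x)).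
split=> /= [|v w ev_v ev_w]; first by rewrite (morph_monoid f'M).1.
suff -> : f' (v / w) = ev (v / w) by [].
by rewrite f'M evM (morphV _ f'M) (morphV (fun u => ev u) evM) ev_v ev_w.
Qed.

End FreeGroup.

Definition derived_normalSubgroup (G : groupType) (n : nat) : normalSubgroup G :=
  NormalSubgroup (derived_normal G n).

Definition free_metabelian (X : choiceType) : groupType :=
  quotient_group (derived_normalSubgroup (free_group X) 2).

Lemma free_metabelian_fg (X : finType) : finitely_generated (free_metabelian X).
Proof.
pose p := coset (derived_normalSubgroup (free_group X) 2).
exists (range (fun x : X => p (fg_gen x))).
  exact: finite_image.
apply/seteqP; split=> // u _; rewrite -(coset_repr u) => H gH SH.
suff /seteqP[_ /(_ (repr u))]: [set v | H (p v)] = setT by apply.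
apply: fg_gen_ind => [|x] /=; last by apply: SH; exists x.
split=> /= [|v w Hv Hw]; first by rewrite /p gmulf1; exact: gH.1.
by rewrite /p gmulfF; apply: gH.2.
Qed.

(* Main.v *)
From HB Require Import structures.
Require Import Defs.
From mathcomp Require Import all_boot all_order all_algebra.
From mathcomp Require Import zify ring.
From mathcomp Require Import boolp classical_sets functions cardinality.

(** The automorphisms of [Phi], the free metabelian group on [x] and [y], act
on its abelianization [Z^2]; call [f] congruent to 1 mod [m] when it acts
trivially on [(Z/m)^2].  Two facts are in conflict.

Congruence subgroups contain many second commutators.  Let [K] be
characteristic of finite index, let [M = Phi/K], and choose [m > 0] with
[x^m] and [y^m] in [K].  An automorphism congruent to 1 mod [m] induces on
[M] an automorphism that is trivial on the abelianization of [M], an IA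
automorphism.  For a metabelian group generated by two elements these form
a metabelian group ([IA_metabelian]): the derived subgroup [M'] is a cyclic
module over the group ring of [M/M'], generated by [[~ x, y]], so that IA
automorphisms act on it by commuting module endomorphisms; hence their
commutators fix [M'] pointwise, and IA automorphisms which fix [M']
pointwise commute.  So [Gamma[K]] contains every
[[~ [~ f1, f2], [~ f3, f4]]] with the [fi] congruent to 1 mod [m]
([second_derived_congruence]).

Some finite index subgroup contains no such set, whatever [m] is.  The
matrices [a = (1 2; 0 1)] and [b = (1 0; 2 1)] generate a free group of finite
index in [GL_2(Z)], and sending them to the 3-cycles [(0 1 2)] and [(2 3 4)]
maps this group onto the alternating group [A_5].  The subgroup is
essentially the kernel of that map.  Instead of the freeness of [a] and [b]
the proof uses a coloring of the vectors of [Z^2] with odd first and even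
second coordinate by the five points: [(1, 0)] has color 3, and [a] and [b]
permute the colors by the two 3-cycles.  A descent, which always subtracts
twice the smaller coordinate from the larger one, shows that such a coloring
exists ([label_shift1], [label_shift2]) and that every matrix of determinant 1
which is trivial mod 4 permutes the colors ([label_unimodular]).  The
automorphisms that are congruent to 1 mod 4 and preserve all colors therefore
form a subgroup of finite index.

Finally, no congruence controls the colors.  For every [m] there is [e]
with [e = 2] mod 3 such that [t = 2e] is idempotent mod [m].  At the
prime powers where [t = 0] the product [a^e b^-e a^e] is trivial, and where
[t = 1] it is the quarter turn [(0 1; -1 0)].  Its fourth power [w] is thus
trivial mod [m].  On colors, however, [a^e] and [b^e] are the inverses of the
two 3-cycles, for all [m], and [[~ [~ w, w ^ a], [~ w, w ^ b]]] acts as a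
5-cycle: it belongs to [Gamma[K]] but does not preserve the colors. *)

Set Implicit Arguments.
Unset Strict Implicit.
Unset Printing Implicit Defensive.

Import Order.TTheory GRing.Theory Num.Theory.

Local Open Scope classical_set_scope.
Local Open Scope group_scope.

(** * Derived subgroups and two-generator groups *)

Section Morphisms.
Variables (G H : groupType) (f : UMagmaMorphism.type G H).

Lemma preimage_subgroup (S : set H) : is_subgroup S -> is_subgroup (f @^-1` S).
Proof.
move=> [S1 SF]; split=> [|x y] /=; first by rewrite gmulf1.
by rewrite gmulfF; exact: SF.
Qed.

Lemma image_subgroup (S : set G) : is_subgroup S -> is_subgroup (f @` S).
Proof.
move=> [S1 SF]; split=> [|_ _ [x Sx <-] [y Sy <-]].
  by exists 1; rewrite ?gmulf1.
by exists (x / y); rewrite ?gmulfF //; exact: SF.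
Qed.

Lemma morph_derived n x :
  @derived_subgroup G n x -> @derived_subgroup H n (f x).
Proof.
elim: n x => [//|n IHn] x /= Dx.
apply: (Dx (f @^-1` derived_subgroup n.+1)).
  exact: preimage_subgroup (generated_subgroup _).
move=> _ [u [v [Du Dv ->]]]; apply: sub_generated.
by exists (f u), (f v); rewrite gmulfR; split=> //; exact: IHn.
Qed.

Lemma derived_image n : (forall y, exists x, f x = y) ->
  @derived_subgroup H n `<=` f @` @derived_subgroup G n.
Proof.
move=> f_onto; elim: n => [|n IHn] y /= Dy.
  by have [x <-] := f_onto y; exists x.
apply: (Dy (f @` derived_subgroup n.+1)).
  exact: image_subgroup (generated_subgroup _).
move=> _ [_ [_ [/IHn[u Du <-] /IHn[v Dv <-] ->]]].
exists [~ u, v]; last exact: gmulfR.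
by apply: sub_generated; exists u, v.
Qed.

End Morphisms.

Section Derived.
Variable G : groupType.

Lemma subgroup_derived n : is_subgroup (@derived_subgroup G n).
Proof. exact: (derived_normal G n).1. Qed.

Lemma derivedJ n c u : @derived_subgroup G n c -> @derived_subgroup G n (c ^ u).
Proof. exact: (derived_normal G n).2. Qed.

Lemma commg_derived1 u v : @derived_subgroup G 1 [~ u, v].
Proof. by apply: sub_generated; exists u, v. Qed.

End Derived.

Lemma coset_onto (G : groupType) (N : normalSubgroup G) v :
  exists u, coset N u = v.
Proof. by exists (repr v); exact: coset_repr. Qed.

Definition metabelian (G : groupType) := forall c d : G,
  @derived_subgroup G 1 c -> @derived_subgroup G 1 d -> commute c d.

Lemma metabelianP (G : groupType) :
  metabelian G <-> @derived_subgroup G 2 `<=` [set 1].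
Proof.
split=> [abG c Dc|G2 c d Dc Dd].
  apply: (Dc [set 1]); first by split=> // _ _ -> ->; rewrite divg1.
  by move=> _ [u [v [Du Dv ->]]] /=; apply/eqP/commgP; exact: abG.
by apply/commgP/eqP; apply: (G2 [~ c, d]); apply: sub_generated; exists c, d.
Qed.

Definition generated_by (G : groupType) (x y : G) :=
  forall S : set G, is_subgroup S -> S x -> S y -> forall u, S u.

Lemma morph_metabelian (G H : groupType) (f : UMagmaMorphism.type G H) :
  (forall y, exists x, f x = y) -> metabelian G -> metabelian H.
Proof.
move=> f_onto abG c d Dc Dd.
have [u Du <-] := derived_image f_onto Dc.
have [v Dv <-] := derived_image f_onto Dd.
exact/gmulf_commute/abG.
Qed.

Lemma morph_generated_by (G H : groupType) (f : UMagmaMorphism.type G H) x y :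
  (forall y, exists x, f x = y) -> generated_by x y -> generated_by (f x) (f y).
Proof.
move=> f_onto gen_xy S gS Sx Sy v; have [u <-] := f_onto v.
exact: gen_xy (preimage_subgroup f gS) Sx Sy u.
Qed.

Lemma centralizer_subgroup (G : groupType) (u : G) : is_subgroup (commute u).
Proof.
by split=> [|v w uv uw]; [exact: commute1 | exact/commuteM/commuteV].
Qed.

Lemma generated_by_commutative (G : groupType) (x y : G) :
  generated_by x y -> commute x y -> forall u v : G, commute u v.
Proof.
move=> gen_xy xy u v; have gen z := gen_xy _ (centralizer_subgroup z).
apply: (gen u); apply/commute_sym; apply: gen => //; exact: commute_sym.
Qed.

(** In the quotient by [N] the two generators commute, so the quotient is
abelian.  Hence the derived subgroup is the normal closure of the single
commutator [[~ x, y]]. *)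
Lemma derived1_sub_normal (G : groupType) (x y : G) (N : set G) :
  generated_by x y -> is_normal N -> N [~ x, y] -> derived_subgroup 1 `<=` N.
Proof.
move=> gen_xy nN Nxy c; apply; first exact: nN.1.
pose p : UMagmaMorphism.type _ _ := coset (NormalSubgroup nN).
have coset1 z : p z = 1 <-> N z.
  by rewrite -[1]/(p 1) coset_eqP /= mulg1; split=> /(subgroupV nN.1) //;
     rewrite invgK.
have comm_p : forall u v, commute (p u) (p v).
  have gen_p := morph_generated_by (f := p) (@coset_onto _ _) gen_xy.
  move=> u v; apply: (generated_by_commutative gen_p).
  by apply/commgP/eqP; rewrite -gmulfR coset1.
move=> _ [u [v [_ _ ->]]]; apply/coset1.
by rewrite gmulfR; apply/eqP/commgP.
Qed.

(** * IA automorphisms of metabelian groups with two generators *)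

Section IA.
Variables (M : groupType) (x y : M).
Hypotheses (abM : metabelian M) (gen_xy : generated_by x y).
Local Notation D := (@derived_subgroup M 1).

Let gD : is_subgroup D := subgroup_derived M 1.

(** Conjugation on [D] factors through the abelianization of [M]: this is the
module structure of [D] over the group ring of [M / D]. *)
Lemma conjg_derived1 c u d : D c -> D d -> c ^ (u * d) = c ^ u.
Proof.
move=> Dc Dd; rewrite conjgM; apply/conjg_fixP/commgP.
by apply: abM => //; exact: derivedJ.
Qed.

Lemma conjg_derived1C c u v : D c -> (c ^ u) ^ v = (c ^ v) ^ u.
Proof.
move=> Dc; rewrite -!conjgM [u * v]commgC conjg_derived1 //.
exact: commg_derived1.
Qed.

(** Endomorphisms of [D] as a module over the group ring, represented by
functions on all of [M] that are compared only on [D]. *)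
Definition derived_endo (t : M -> M) :=
  [/\ forall c, D c -> D (t c),
      forall c d, D c -> D d -> t (c * d) = t c * t d
    & forall c u, D c -> t (c ^ u) = t c ^ u].

(** These stand for the multiplications by elements of the group ring. *)
Definition central_endo (r : M -> M) := derived_endo r /\
  forall t, derived_endo t -> forall c, D c -> t (r c) = r (t c).

Lemma derived_endo1 t : derived_endo t -> t 1 = 1.
Proof.
move=> [_ tM _]; apply: (@mulgI _ (t 1)).
by rewrite -tM ?mulg1 //; exact: gD.1.
Qed.

Lemma derived_endoV t c : derived_endo t -> D c -> t c^-1 = (t c)^-1.
Proof.
move=> et Dc; apply: (@mulgI _ (t c)); case: (et) => _ tM _.
by rewrite -tM ?mulgV ?(derived_endo1 et) //; exact: (subgroupV gD).
Qed.

(** [D] is a cyclic module: its elements that are a multiple [r [~ x, y]] of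
the generator form a normal subgroup containing [[~ x, y]].  Multiples are
closed under products and conjugation because conjugations commute on [D]. *)
Lemma central_endo_onto d : D d -> exists2 r, central_endo r & r [~ x, y] = d.
Proof.
apply: (derived1_sub_normal gen_xy
  (N := [set d | exists2 r, central_endo r & r [~ x, y] = d])); last first.
  by exists id => //; split=> // c.
split; first split=> [|_ _ [r cr <-] [s cs <-]].
- exists (fun=> 1) => //; split; first split=> //.
  + by move=> *; exact: gD.1.
  + by move=> *; rewrite mulg1.
  + by move=> *; rewrite conj1g.
  + by move=> t et c _; exact: derived_endo1.
- have [[[Dr rM rJ] rC] [[Ds sM sJ] sC]] := (cr, cs).
  exists (fun c => r c / s c) => //; split; first split.
  + by move=> c Dc; apply: gD.2; [exact: Dr | exact: Ds].
  + move=> c e Dc De; rewrite rM // sM // invgM -!mulgA; congr (_ * _).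
    rewrite mulgA; apply: abM; first by apply: gD.2; [exact: Dr | exact: Ds].
    by apply: (subgroupV gD); exact: Ds.
  + by move=> c u Dc; rewrite rJ // sJ // conjMg conjVg.
  + move=> t et c Dc; have [_ tM _] := et.
    have := Ds _ Dc; have := Dr _ Dc => Drc Dsc.
    rewrite tM //; last exact: (subgroupV gD).
    by rewrite derived_endoV // rC // sC.
- move=> _ u [r cr <-]; have [[Dr rM rJ] rC] := cr.
  exists (fun c => r c ^ u) => //; split; first split.
  + by move=> c Dc; apply: derivedJ; exact: Dr.
  + by move=> c e Dc De; rewrite rM // conjMg.
  + by move=> c v Dc; rewrite rJ // conjg_derived1C //; exact: Dr.
  + by move=> t et c Dc; have [_ _ tJ] := et; rewrite tJ ?rC //; exact: Dr.
Qed.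

(** The endomorphism ring of a cyclic module over a commutative ring is
commutative: on the generator, [t1] and [t2] agree with multiplications [r1] and
[r2], which commute with everything. *)
Lemma derived_endoC t1 t2 c :
  derived_endo t1 -> derived_endo t2 -> D c -> t1 (t2 c) = t2 (t1 c).
Proof.
move=> e1 e2 /central_endo_onto[r [er rC] <-].
have Dxy := commg_derived1 x y.
have [[D1 _ _] [D2 _ _]] := (e1, e2).
have [r1 [er1 rC1] r1xy] := central_endo_onto (D1 _ Dxy).
have [r2 [er2 rC2] r2xy] := central_endo_onto (D2 _ Dxy).
rewrite (rC _ e1 _ Dxy) (rC _ e2 _ Dxy).
rewrite (rC _ e1 _ (D2 _ Dxy)) (rC _ e2 _ (D1 _ Dxy)); congr (r _).
have t12 := rC2 _ e1 _ Dxy; have t21 := rC1 _ e2 _ Dxy.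
rewrite r2xy in t12; rewrite r1xy in t21.
by rewrite t12 t21 -r1xy -r2xy; exact: (rC1 _ er2 _ Dxy).
Qed.

Definition IA (f : aut M) := forall u, D (u^-1 * f u).

Lemma IA_generators (f : aut M) : D (x^-1 * f x) -> D (y^-1 * f y) -> IA f.
Proof.
apply: gen_xy; split=> [|u v]; rewrite /mkset; last move=> Du Dv.
  by rewrite gmulf1 mulg1 invg1; exact: gD.1.
have -> : (u / v)^-1 * f (u / v) = ((u^-1 * f u) / (v^-1 * f v)) ^ v^-1.
  by rewrite gmulfF invgF conjgE invgM !invgK !mulgA mulgK.
by apply: derivedJ; exact: gD.2.
Qed.

(** An IA automorphism moves [u] by an element of [D], which does not change
conjugation by [u] on [D]. *)
Lemma IA_derived_endo f : IA f -> derived_endo f.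
Proof.
move=> IAf; split=> [c||c u Dc].
- exact: morph_derived.
- by move=> *; exact: autM.
- have -> : f (c ^ u) = f c ^ f u by exact: gmulfJ.
  rewrite -(mulVKg u (f u)) conjg_derived1 //; exact: morph_derived.
Qed.

Lemma subgroup_IA : is_subgroup IA.
Proof.
split=> [u|f g IAf IAg u]; first by rewrite /= mulVg; exact: gD.1.
have [v ->] : exists v, u = g v by exists (g^-1 u); rewrite /= aut_inv_funK.
have -> : (f / g) (g v) = f v by rewrite /= aut_funK.
have -> : (g v)^-1 * f v = (v^-1 * g v)^-1 * (v^-1 * f v).
  by rewrite invgM invgK -mulgA mulVKg.
by apply: (subgroupM gD) => //; exact: (subgroupV gD).
Qed.

Lemma IA_commutator_fix f g c : IA f -> IA g -> D c -> [~ f, g] c = c.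
Proof.
move=> IAf IAg Dc; apply: (bij_inj (aut_bij (g * f))).
rewrite -[LHS]/((g * f * [~ f, g]) c) -commgC /=.
by apply: derived_endoC => //; exact: IA_derived_endo.
Qed.

(** Such [f] and [g] only multiply [u] by elements [u^-1 * f u] and
[u^-1 * g u] of [D]; both are fixed by [f] and [g], and they commute. *)
Lemma IA_fix_commute f g : IA f -> IA g ->
  (forall c, D c -> f c = c) -> (forall c, D c -> g c = c) -> commute f g.
Proof.
move=> IAf IAg f_fix g_fix; apply: autP => u /=.
have -> : f (g u) = f u * (u^-1 * g u).
  by rewrite -{1}(mulVKg u (g u)) autM (f_fix _ (IAg u)).
have -> : g (f u) = g u * (u^-1 * f u).
  by rewrite -{1}(mulVKg u (f u)) autM (g_fix _ (IAf u)).
rewrite -{1}(mulVKg u (f u)) -mulgA.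
by rewrite (abM (IAf u) (IAg u)) mulgA mulVKg.
Qed.

(** Commutators of IA automorphisms fix [D] pointwise, as the automorphisms
commute on [D]; and those fixing [D] pointwise commute on all of [M]. *)
Lemma IA_metabelian f1 f2 f3 f4 : IA f1 -> IA f2 -> IA f3 -> IA f4 ->
  [~ [~ f1, f2], [~ f3, f4]] = 1.
Proof.
move=> IA1 IA2 IA3 IA4.
have gIA := subgroup_IA.
have IAR f g : IA f -> IA g -> IA [~ f, g].
  move=> IAf IAg; rewrite commgEl conjgE.
  apply: (subgroupM gIA); first exact: (subgroupV gIA).
  by apply: (subgroupM gIA); [exact: (subgroupV gIA) | exact: (subgroupM gIA)].
apply/eqP/commgP/IA_fix_commute => //; do ?exact: IAR.
  by move=> c; exact: IA_commutator_fix.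
by move=> c; exact: IA_commutator_fix.
Qed.

End IA.

(** * Labelling vectors by descent *)

Section Labelling.
Local Open Scope ring_scope.

Variables (T : Type) (a a' b b' : T -> T) (t0 : T).
Hypotheses (aK : cancel a a') (a'K : cancel a' a).
Hypotheses (bK : cancel b b') (b'K : cancel b' b).
Hypothesis a_t0 : a t0 = t0.

(** On these vectors the two coordinates never have the same absolute value
and the first is never 0, so that the descent below can always proceed, until
the second coordinate is 0.  They are permuted by the matrices
[(1 2; 0 1)] and [(1 0; 2 1)]. *)
Definition odd_even (x y : int) := (~~ (2 %| x) && (2 %| y))%Z.

(** The smaller coordinate is subtracted twice from the larger one, or added
twice, so as to decrease the latter in absolute value; each step back
up applies [a^+-1] or [b^+-1] to the label.  The argument [n] bounds the number
of steps. *)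
Fixpoint label_rec n (x y : int) : T :=
  if n is n'.+1 then
    if y == 0 then t0
    else if `|y| < `|x| then
      if (0 < x) == (0 < y) then a (label_rec n' (x - 2 * y) y)
      else a' (label_rec n' (x + 2 * y) y)
    else
      if (0 < x) == (0 < y) then b (label_rec n' x (y - 2 * x))
      else b' (label_rec n' x (y + 2 * x))
  else t0.

Definition label (x y : int) := label_rec (absz x + absz y) x y.

Lemma odd_even_shift1 x y k : odd_even x y -> odd_even (x + 2 * k * y) y.
Proof. by rewrite /odd_even; lia. Qed.

Lemma odd_even_shift2 x y k : odd_even x y -> odd_even x (y + 2 * k * x).
Proof. by rewrite /odd_even; lia. Qed.

(** Each step decreases the sum of the absolute values of the coordinates, so
that any larger bound gives the same label. *)
Lemma label_recE n m x y : odd_even x y ->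
  (absz x + absz y <= n)%N -> (absz x + absz y <= m)%N ->
  label_rec n x y = label_rec m x y.
Proof.
elim: n m x y => [|n IHn] [|m] x y //=; rewrite /odd_even => xy le_n le_m;
  try lia.
case: eqP => // y0.
by case: ifP => lt_yx; case: ifP => xy_sg; congr (_ _); apply: IHn;
  rewrite /odd_even; lia.
Qed.

Lemma label_unfold x y : odd_even x y -> label x y =
  if y == 0 then t0
  else if `|y| < `|x| then
    if (0 < x) == (0 < y) then a (label (x - 2 * y) y)
    else a' (label (x + 2 * y) y)
  else
    if (0 < x) == (0 < y) then b (label x (y - 2 * x))
    else b' (label x (y + 2 * x)).
Proof.
move=> xy; rewrite [in LHS]/label (@label_recE _ (absz x + absz y).+1) //=.
move: xy; rewrite /odd_even => xy; case: eqP => // y0.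
by case: ifP => lt_yx; case: ifP => xy_sg; congr (_ _); apply: label_recE;
  rewrite /odd_even; lia.
Qed.

(** One of the vectors [(x, y)] and [(x + 2 y, y)] is obtained from the other
by a step of the descent, except when [y = 0]: there both are the same
vector, and [a] must fix its label [t0]. *)
Lemma label_shift1 x y : odd_even x y -> label (x + 2 * y) y = a (label x y).
Proof.
move=> xy; have xy' : odd_even (x + 2 * y) y.
  by move: xy; rewrite /odd_even; lia.
have [y0|y0] := eqVneq y 0.
  by rewrite y0 mulr0 addr0 label_unfold -?y0 // y0 eqxx a_t0.
have [/andP[lt_y sg]|opp] :=
    boolP ((`|y| < `|x + 2 * y|) && ((0 < x + 2 * y) == (0 < y))).
  by rewrite (label_unfold xy') (negPf y0) lt_y sg addrK.
rewrite (label_unfold xy) (negPf y0) ifT ?ifF ?a'K //;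
  by move: xy opp; rewrite /odd_even; lia.
Qed.

Lemma label_shift2 x y : odd_even x y -> label x (y + 2 * x) = b (label x y).
Proof.
move=> xy; have xy' : odd_even x (y + 2 * x).
  by move: xy; rewrite /odd_even; lia.
have [/andP[lt_y sg]|opp] :=
    boolP ((`|x| < `|y + 2 * x|) && ((0 < x) == (0 < y + 2 * x))).
  have ge_y : (`|y + 2 * x| < `|x|) = false by move: lt_y; lia.
  have y'0 : (y + 2 * x == 0) = false by move: xy; rewrite /odd_even; lia.
  by rewrite (label_unfold xy') y'0 ge_y sg addrK.
have ge_y : (`|y| < `|x|) = false by move: xy opp; rewrite /odd_even; lia.
have y0 : (y == 0) = false by move: xy opp; rewrite /odd_even; lia.
have sg : ((0 < x) == (0 < y)) = false by move: xy opp; rewrite /odd_even; lia.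
by rewrite (label_unfold xy) y0 ge_y sg b'K.
Qed.

Lemma odd_even_mx p q r s i j : ~~ (2 %| p)%Z -> (2 %| q)%Z -> (2 %| r)%Z ->
  odd_even i j -> odd_even (p * i + q * j) (r * i + s * j).
Proof.
move=> p1 q0 r0 /andP[i1 j0].
have oddE z : ~~ (2 %| z)%Z -> exists z', z = 2 * z' + 1.
  by move=> z1; exists (z %/ 2)%Z; lia.
have evenE z : (2 %| z)%Z -> exists z', z = 2 * z'.
  by move=> z0; exists (z %/ 2)%Z; lia.
move/oddE: p1 => [p' pE]; move/oddE: i1 => [i' iE].
move/evenE: q0 => [q' qE]; move/evenE: r0 => [r' rE]; move/evenE: j0 => [j' jE].
have -> : p * i + q * j = 2 * (2 * p' * i' + p' + i' + 2 * q' * j') + 1.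
  by rewrite pE iE qE jE; ring.
have -> : r * i + s * j = 2 * (r' * i + s * j') by rewrite rE jE; ring.
suff H m k : odd_even (2 * m + 1) (2 * k) by exact: H.
by rewrite /odd_even; lia.
Qed.

Lemma label_shift1_iter k : exists t : T -> T, forall x y, odd_even x y ->
  label (x + 2 * k * y) y = t (label x y).
Proof.
have shift n x y : odd_even x y ->
    label (x + 2 * n%:Z * y) y = iter n a (label x y).
  move=> xy; elim: n => [|n IHn]; first by congr label; ring.
  have xy' := odd_even_shift1 n xy.
  by rewrite iterS -IHn -label_shift1 //; congr label; lia.
have [n kE] : exists n : nat, k = n%:Z \/ k = - n%:Z by exists (absz k); lia.
case: kE => ->; first by exists (iter n a); exact: shift.
exists (iter n a') => x y xy.
have xy' := odd_even_shift1 (- n%:Z) xy.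
have -> : label x y = iter n a (label (x + 2 * - n%:Z * y) y).
  by rewrite -shift //; congr label; ring.
move: (label (x + 2 * _ * y) y) => t; clear xy'.
by elim: n => // n IHn; rewrite iterSr iterS aK -IHn.
Qed.

(** The same descent on the first column [(p, r)] writes the matrix as a product
of the two transvections and their inverses, each of which acts on labels.  The
condition mod 4 on [p] is invariant during the descent and excludes a final
column [(-1, 0)]. *)
Lemma label_unimodular p q r s :
  (4 %| p - 1)%Z -> (2 %| q)%Z -> (2 %| r)%Z -> p * s - q * r = 1 ->
  exists t : T -> T, forall i j, odd_even i j ->
    label (p * i + q * j) (r * i + s * j) = t (label i j).
Proof.
have [n] := ubnP (absz p + absz r); elim: n p q r s => // n IHn p q r s.
move=> le_n p1 q0 r0 det1.
have s1 : ~~ (2 %| s)%Z.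
  have [p' pE] : exists p', p = 2 * p' + 1 by exists (p %/ 2)%Z; lia.
  have [q' qE] : exists q', q = 2 * q' by exists (q %/ 2)%Z; lia.
  by apply/negP => /dvdzP[s' sE]; move: det1; rewrite pE qE sE; lia.
have [r_eq0|r_neq0] := eqVneq r 0.
  have p_unit : p * s = 1 by rewrite -det1 r_eq0; ring.
  have pE : p = 1.
    have /eqP := congr1 absz p_unit.
    by rewrite abszM muln_eq1 => /andP[/eqP p_abs _]; lia.
  have sE : s = 1 by rewrite pE in p_unit; lia.
  have [t tE] := label_shift1_iter (q %/ 2)%Z.
  by exists t => i j ij; rewrite -tE // r_eq0 pE sE; congr label; lia.
have [lt_rp|le_pr] := ltP `|r| `|p|.
  have [sg|sg] := boolP ((0 < p) == (0 < r)).
    have [|||||t tE] := IHn (p - 2 * r) (q - 2 * s) r s; try lia.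
    exists (a \o t) => i j ij /=; rewrite -tE // -label_shift1.
      by congr label; ring.
    by apply: odd_even_mx => //; lia.
  have [|||||t tE] := IHn (p + 2 * r) (q + 2 * s) r s; try lia.
  exists (a' \o t) => i j ij /=; rewrite -tE //.
  have -> : (p + 2 * r) * i + (q + 2 * s) * j =
    p * i + q * j + 2 * (r * i + s * j) by ring.
  by rewrite label_shift1 ?aK //; apply: odd_even_mx => //; lia.
have [sg|sg] := boolP ((0 < p) == (0 < r)).
  have [|||||t tE] := IHn p q (r - 2 * p) (s - 2 * q); try lia.
  exists (b \o t) => i j ij /=; rewrite -tE // -label_shift2.
    by congr label; ring.
  by apply: odd_even_mx => //; lia.
have [|||||t tE] := IHn p q (r + 2 * p) (s + 2 * q); try lia.
exists (b' \o t) => i j ij /=; rewrite -tE //.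
have -> : (r + 2 * p) * i + (s + 2 * q) * j =
  r * i + s * j + 2 * (p * i + q * j) by ring.
by rewrite label_shift2 ?bK //; apply: odd_even_mx => //; lia.
Qed.

End Labelling.

(** * The free metabelian group of rank two and its abelianization *)

Definition morphism_of (G H : groupType) (f : G -> H)
    (fM : {morph f : u v / u * v}) : UMagmaMorphism.type G H :=
  HB.pack f (isUMagmaMorphism.Build G H f (morph_monoid fM)).

Lemma generated_by_eq (G H : groupType) (x y : G) (f g : G -> H) :
  generated_by x y ->
  {morph f : u v / u * v} -> {morph g : u v / u * v} ->
  f x = g x -> f y = g y -> f =1 g.
Proof.
move=> gen_xy fM gM fgx fgy; apply: gen_xy => //.
split=> [|u v]; rewrite /mkset; last move=> fgu fgv.
  by rewrite (morph_monoid fM).1 (morph_monoid gM).1.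
have fV : f v^-1 = (f v)^-1 := gmulfV (morphism_of fM) v.
have gV : g v^-1 = (g v)^-1 := gmulfV (morphism_of gM) v.
by rewrite fM gM fV gV fgu fgv.
Qed.

Local Open Scope ring_scope.
Local Open Scope group_scope.

Local Notation Phi := (free_metabelian 'I_2).
Local Notation Z2 := (int * int)%type.
Local Notation mulZ2 := (GRing.to_multiplicative Z2).
Local Notation phi_coset :=
  (coset (derived_normalSubgroup (free_group 'I_2) 2)).

Definition gen_x : Phi := phi_coset (fg_gen ord0).
Definition gen_y : Phi := phi_coset (fg_gen ord_max).

Lemma Phi_metabelian : metabelian Phi.
Proof.
apply/metabelianP => u Du.
have [w Dw <-] := derived_image (@coset_onto _ _) Du.
apply/esym/coset_eqP; rewrite invg1 mul1g; exact: Dw.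
Qed.

Lemma Phi_generated : generated_by gen_x gen_y.
Proof.
move=> S gS Sx Sy u; rewrite -(coset_repr u).
suff /seteqP[_ /(_ (repr u))] : phi_coset @^-1` S = setT by apply.
apply: fg_gen_ind => [|i]; first exact: preimage_subgroup.
by case: i => [[|[|i]] lt_i] //=; [move: Sx|move: Sy];
  congr (S (phi_coset (fg_gen _))); apply: val_inj.
Qed.

Lemma Phi_universal (G : groupType) (a b : G) : metabelian G ->
  exists2 f : Phi -> G, {morph f : u v / u * v} & f gen_x = a /\ f gen_y = b.
Proof.
move=> abG.
have [h [hM hgen] _] :=
  free_group_universal (fun i : 'I_2 => if i == ord0 then a else b).
pose h' := morphism_of hM.
have h_coset u v : phi_coset u = phi_coset v -> h u = h v.
  move=> /coset_eqP Duv; have h1 : h (u^-1 * v) = 1.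
    exact: ((metabelianP G).1 abG _ (morph_derived h' Duv)).
  by have := hM u (u^-1 * v); rewrite mulVKg h1 mulg1.
exists (fun u => h (repr u)) => [u v|].
  by rewrite -hM; apply: h_coset; rewrite cosetM !coset_repr.
by split; [rewrite -[a](hgen ord0)|rewrite -[b](hgen ord_max)];
  apply: h_coset; exact: coset_repr.
Qed.

Lemma Z2_metabelian : metabelian mulZ2.
Proof. by move=> u v _ _; exact: addrC. Qed.

Lemma abelianization_subproof : exists f : UMagmaMorphism.type Phi mulZ2,
  f gen_x = (1%R, 0%R) /\ f gen_y = (0%R, 1%R).
Proof.
have [f fM fxy] := @Phi_universal mulZ2 (1%R, 0%R) (0%R, 1%R) Z2_metabelian.
by exists (morphism_of fM).
Qed.

Definition ab : UMagmaMorphism.type Phi mulZ2 :=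
  projT1 (cid abelianization_subproof).

Lemma ab_x : ab gen_x = (1%R, 0%R).
Proof. exact: (projT2 (cid abelianization_subproof)).1. Qed.

Lemma ab_y : ab gen_y = (0%R, 1%R).
Proof. exact: (projT2 (cid abelianization_subproof)).2. Qed.

Section ScaledAbelianization.
Variables (A : groupType) (q : UMagmaMorphism.type Phi A) (m : nat).
Hypotheses (m_gt0 : (0 < m)%N) (A_comm : forall u v : A, commute u v).
Hypotheses (qx : q gen_x ^+ m = 1) (qy : q gen_y ^+ m = 1).

Lemma expg_mod (g : A) i : g ^+ m = 1 -> g ^+ i = g ^+ (i %% m).
Proof.
by move=> gm; rewrite {1}(divn_eq i m) expgnDr mulnC expgnA gm expg1n mul1g.
Qed.

(** A morphism [q] to an abelian group in which the images of the generators
have exponent [m] factors through [Z^2 / m]: every [q u] is a product of powers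
of the two images, with exponents congruent to [ab u]; as [m > 0], these
exponents can be taken to be natural numbers. *)
Lemma morph_eq1_of_ab u :
  (m%:Z %| (ab u).1)%Z -> (m%:Z %| (ab u).2)%Z -> q u = 1.
Proof.
have dvd_sub (a b : int) (i k : nat) :
    (m%:Z %| a - i%:Z)%Z -> (m%:Z %| b - k%:Z)%Z ->
    (m%:Z %| (a - b)%R - (i + m.-1 * k)%N%:Z)%Z.
  move=> ai bk; have -> : ((a - b) - (i + m.-1 * k)%N%:Z =
      (a - i%:Z) - (b - k%:Z) - k%:Z * m%:Z)%R.
    by rewrite -{2}(prednK m_gt0); lia.
  by apply: rpredB; [exact: rpredB | exact: dvdz_mull].
have : exists i j : nat, [/\ q u = q gen_x ^+ i * q gen_y ^+ j,
    (m%:Z %| (ab u).1 - i%:Z)%Z & (m%:Z %| (ab u).2 - j%:Z)%Z].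
  move: u; apply: Phi_generated; [split=> [|u v]| |].
  - by exists 0%N, 0%N; rewrite !gmulf1 /= !expg0 mulg1.
  - move=> [i [j [qu ui uj]]] [k [l [qv vk vl]]].
    (* The inverse of [g ^+ k] is [g ^+ (m.-1 * k)] when [g ^+ m = 1]. *)
    exists (i + (m.-1 * k))%N, (j + (m.-1 * l))%N.
    have expV (g : A) n : g ^+ m = 1 -> g ^+ (m.-1 * n) = (g ^+ n)^-1.
      move=> gm; apply/esym/mulg1_eq; rewrite -expgnDr -mulSn prednK //.
      by rewrite expgnA gm expg1n.
    rewrite !gmulfF qu qv !expgnDr !expV // invgM; split.
    + rewrite -!mulgA; congr (_ * _).
      by rewrite mulgA; apply: A_comm.
    + exact: dvd_sub.
    + exact: dvd_sub.
  - by exists 1%N, 0%N; rewrite ab_x /= expg1 expg0 mulg1.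
  - by exists 0%N, 1%N; rewrite ab_y /= expg1 expg0 mul1g.
move=> [i [j [-> ui uj]]] u1 u2.
have dvd_nat (a : int) (k : nat) :
    (m%:Z %| a)%Z -> (m%:Z %| a - k%:Z)%Z -> (k %% m = 0)%N.
  move=> ma mak; apply/eqP.
  rewrite -[_ == _]/(m %| k)%N -[(m %| k)%N]/(m%:Z %| k%:Z)%Z.
  by rewrite -[k%:Z](subKr a); exact: rpredB.
rewrite (expg_mod i) // (expg_mod j) //.
by rewrite (dvd_nat _ _ u1 ui) (dvd_nat _ _ u2 uj) !expg0 mulg1.
Qed.

End ScaledAbelianization.

(** The action of an automorphism on the abelianization [Z^2], given by the
matrix whose columns are the images of the two generators. *)
Definition act (f : aut Phi) (v : Z2) : Z2 :=
  ((ab (f gen_x)).1 * v.1 + (ab (f gen_y)).1 * v.2,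
   (ab (f gen_x)).2 * v.1 + (ab (f gen_y)).2 * v.2)%R.

Lemma act_ab (f : aut Phi) u : ab (f u) = act f (ab u).
Proof.
move: u; apply: (generated_by_eq (H := mulZ2) Phi_generated).
- by move=> u v; rewrite !gmulfM.
- by move=> u v; rewrite gmulfM; congr pair => /=; ring.
- by rewrite /act ab_x /= !mulr1 !mulr0 !addr0 -surjective_pairing.
- by rewrite /act ab_y /= !mulr1 !mulr0 !add0r -surjective_pairing.
Qed.

Lemma actM (f g : aut Phi) v : act (f * g) v = act f (act g v).
Proof.
have fgE u : ab ((f * g) u) = act f (ab (g u)) by exact: (act_ab f (g u)).
by rewrite {1}/act !fgE; congr pair => /=; ring.
Qed.

Lemma act1 (v : Z2) : act 1 v = v.
Proof.
have E u : ab ((1 : aut Phi) u) = ab u by [].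
by case: v => i j; rewrite /act !E ab_x ab_y; congr pair => /=; ring.
Qed.

Lemma actK (f : aut Phi) v : act f^-1 (act f v) = v.
Proof. by rewrite -actM mulVg act1. Qed.

Lemma actVK (f : aut Phi) v : act f (act f^-1 v) = v.
Proof. by rewrite -actM mulgV act1. Qed.

Definition eqmZ2 (m : nat) (v w : Z2) :=
  (m%:Z %| v.1 - w.1)%Z && (m%:Z %| v.2 - w.2)%Z.

Lemma eqmZ2_refl m v : eqmZ2 m v v.
Proof. by rewrite /eqmZ2 !subrr !dvdz0. Qed.

Lemma eqmZ2_sym m v w : eqmZ2 m v w = eqmZ2 m w v.
Proof. by rewrite /eqmZ2 -[(v.1 - _)%R]opprB -[(v.2 - _)%R]opprB !rpredN. Qed.

Lemma eqmZ2_trans m v w u : eqmZ2 m v w -> eqmZ2 m w u -> eqmZ2 m v u.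
Proof.
move=> /andP[vw1 vw2] /andP[wu1 wu2]; apply/andP.
have E (a b c : int) : (a - c = (a - b) + (b - c))%R by ring.
by rewrite (E v.1 w.1) (E v.2 w.2); split; apply: rpredD.
Qed.

Lemma eqmZ2_act m f v w : eqmZ2 m v w -> eqmZ2 m (act f v) (act f w).
Proof.
move=> /andP[vw1 vw2]; apply/andP; rewrite /act /=.
have E (a b c d e g : int) :
  (a * b + c * d - (a * e + c * g) = a * (b - e) + c * (d - g))%R by ring.
by rewrite !E; split; apply: rpredD; exact: dvdz_mull.
Qed.

Lemma Phi_aut (f g : Phi -> Phi) :
  {morph f : u v / u * v} -> {morph g : u v / u * v} ->
  g (f gen_x) = gen_x -> g (f gen_y) = gen_y ->
  f (g gen_x) = gen_x -> f (g gen_y) = gen_y ->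
  exists h : aut Phi, h =1 f.
Proof.
move=> fM gM gfx gfy fgx fgy.
have fK : cancel f g.
  apply: (generated_by_eq (g := idfun) Phi_generated) => // u v.
  by rewrite fM gM.
have gK : cancel g f.
  apply: (generated_by_eq (g := idfun) Phi_generated) => // u v.
  by rewrite gM fM.
by exists (Aut fM (Bijective fK gK)).
Qed.

(** The automorphism [x |-> x], [y |-> y x^2], which lifts the matrix
[(1 2; 0 1)]. *)
Lemma transvection1 : exists f : aut Phi,
  forall v, act f v = (v.1 + 2 * v.2, v.2)%R.
Proof.
have [f fM [fx fy]] := Phi_universal gen_x (gen_y * gen_x ^+ 2) Phi_metabelian.
have [g gM [gx gy]] := Phi_universal gen_x (gen_y * gen_x ^- 2) Phi_metabelian.
have fX u n : f (u ^+ n) = f u ^+ n := gmulfXn (morphism_of fM) n u.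
have gX u n : g (u ^+ n) = g u ^+ n := gmulfXn (morphism_of gM) n u.
have fV u : f u^-1 = (f u)^-1 := gmulfV (morphism_of fM) u.
have [||||h hE] := Phi_aut fM gM; rewrite ?fx ?fy ?gx ?gy ?fM ?gM ?fV ?gX ?fX
  ?gx ?fx ?gy ?fy ?mulgK ?mulgVK //.
exists h => v; rewrite /act !hE fx fy gmulfM gmulfXn expg2 ab_x ab_y.
by congr pair => /=; rewrite ab_x /=; ring.
Qed.

(** The automorphism [x |-> x y^2], [y |-> y], which lifts the matrix
[(1 0; 2 1)]. *)
Lemma transvection2 : exists f : aut Phi,
  forall v, act f v = (v.1, v.2 + 2 * v.1)%R.
Proof.
have [f fM [fx fy]] := Phi_universal (gen_x * gen_y ^+ 2) gen_y Phi_metabelian.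
have [g gM [gx gy]] := Phi_universal (gen_x * gen_y ^- 2) gen_y Phi_metabelian.
have fX u n : f (u ^+ n) = f u ^+ n := gmulfXn (morphism_of fM) n u.
have gX u n : g (u ^+ n) = g u ^+ n := gmulfXn (morphism_of gM) n u.
have fV u : f u^-1 = (f u)^-1 := gmulfV (morphism_of fM) u.
have [||||h hE] := Phi_aut fM gM; rewrite ?fx ?fy ?gx ?gy ?fM ?gM ?fV ?gX ?fX
  ?gx ?fx ?gy ?fy ?mulgK ?mulgVK //.
exists h => v; rewrite /act !hE fx fy gmulfM gmulfXn expg2 ab_x ab_y.
by congr pair => /=; rewrite ab_y /=; ring.
Qed.

(** Two powers of [u] lie in the same coset. *)
Lemma exponent_of_finite_index (G : groupType) (K : set G) (u : G) :
  is_subgroup K -> finite_index K -> exists2 m, (0 < m)%N & K (u ^+ m).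
Proof.
move=> gK finK.
have [[i j] /= [lt_ij Eij]] : exists ij : nat * nat, (ij.1 < ij.2)%N /\
    left_coset K (u ^+ ij.1) = left_coset K (u ^+ ij.2).
  apply: contrapT => noij.
  have inj : injective (fun i => left_coset K (u ^+ i)).
    move=> i j Eij; apply/eqP; rewrite eqn_leq.
    by apply/andP; split; rewrite leqNgt; apply/negP => lt;
      apply: noij; [exists (j, i) | exists (i, j)].
  apply: infinite_nat.
  suff -> : [set: nat] =
      (fun i => left_coset K (u ^+ i)) @^-1` range (left_coset K).
    by apply: finite_preimage => // i j _ _; exact: inj.
  by apply/seteqP; split=> // i _; exists (u ^+ i).
exists (j - i)%N; first by rewrite subn_gt0.
have : left_coset K (u ^+ i) (u ^+ j).
  by rewrite Eij /left_coset /= mulVg; exact: gK.1.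
by rewrite /left_coset /= -{1}(subnKC (ltnW lt_ij)) expgnDr mulKg.
Qed.

(** * Second commutators in congruence subgroups *)

Lemma quotient_derived_commute (G : groupType) :
  forall u v : quotient_group (derived_normalSubgroup G 1), commute u v.
Proof.
move=> u v; rewrite -(coset_repr u) -(coset_repr v) /commute -!cosetM.
by apply/coset_eqP; rewrite invgM -mulgA; exact: commg_derived1.
Qed.

Definition congruent_id m (f : aut Phi) := forall v, eqmZ2 m (act f v) v.

(** The abelianization of [Phi / K] is a quotient of [(Z/m)^2], where [f] acts
trivially. *)
Lemma congruent_id_induced_IA (K : charSubgroup Phi) m f :
  (0 < m)%N -> char_set K (gen_x ^+ m) -> char_set K (gen_y ^+ m) ->
  congruent_id m f -> IA (induced K f).
Proof.
move=> m_gt0 Kx Ky f1.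
pose p : UMagmaMorphism.type _ _ := coset K.
have gen_p := morph_generated_by (f := p) (@coset_onto _ _) Phi_generated.
pose d : UMagmaMorphism.type _ _ :=
  coset (derived_normalSubgroup (quotient_group K) 1).
pose q : Phi -> _ := fun u => d (p u).
have qM : {morph q : u v / u * v} by move=> u v; rewrite /q !gmulfM.
have pm u : char_set K (u ^+ m) -> morphism_of qM u ^+ m = 1.
  move=> Ku; rewrite -gmulfXn /= /q.
  have -> : p (u ^+ m) = 1.
    by apply/esym/coset_eqP; rewrite invg1 mul1g.
  exact: gmulf1.
have q1 w : eqmZ2 m (act f (ab w)) (ab w) ->
    derived_subgroup 1 ((p w)^-1 * induced K f (p w)).
  move=> /andP[w1 w2].
  have abE : ab (w^-1 * f w) = (act f (ab w) - ab w)%R.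
    by rewrite gmulfM gmulfV act_ab; exact: (@addrC Z2).
  have : morphism_of qM (w^-1 * f w) = 1.
    apply: (morph_eq1_of_ab m_gt0 (@quotient_derived_commute _)
      (pm _ Kx) (pm _ Ky)).
      by rewrite abE.
    by rewrite abE.
  rewrite /= /q => /esym/coset_eqP; rewrite invg1 mul1g gmulfM gmulfV.
  by rewrite /= induced_coset.
by apply: (IA_generators gen_p); apply: q1; exact: f1.
Qed.

Lemma congruent_idJ m f h : congruent_id m f -> congruent_id m (f ^ h).
Proof.
move=> f1 v; rewrite conjgE !actM -[X in eqmZ2 _ _ X](actK h).
by apply: eqmZ2_act; exact: f1.
Qed.

(** The quotient [Phi / K] is again metabelian with two generators, so its IA
automorphisms satisfy this second commutator identity. *)
Lemma second_derived_congruence (K : charSubgroup Phi) m f1 f2 f3 f4 :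
  (0 < m)%N -> char_set K (gen_x ^+ m) -> char_set K (gen_y ^+ m) ->
  congruent_id m f1 -> congruent_id m f2 -> congruent_id m f3 ->
  congruent_id m f4 -> congruence_subgroup K [~ [~ f1, f2], [~ f3, f4]].
Proof.
move=> m_gt0 Kx Ky c1 c2 c3 c4.
have IAi f : congruent_id m f -> IA (induced K f).
  exact: congruent_id_induced_IA m_gt0 Kx Ky.
rewrite /congruence_subgroup /kernel /mkset !gmulfR.
have abM := morph_metabelian (f := coset K) (@coset_onto _ _) Phi_metabelian.
have genM := morph_generated_by (f := coset K) (@coset_onto _ _) Phi_generated.
by apply: (IA_metabelian abM genM); exact: IAi.
Qed.

(** * A finite index subgroup defined by colors *)

Lemma finite_index_of_invariant (G : groupType) (H : set G) (T : finType)
    (F : G -> T) :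
  (forall u v, F u = F v -> H (u^-1 * v)) -> is_subgroup H -> finite_index H.
Proof.
move=> FH gH; rewrite /finite_index.
pose rep_coset t := left_coset H (xget 1 [set u | F u = t]).
apply: (@sub_finite_set _ _ (rep_coset @` setT)); last exact: finite_image.
move=> _ [u _ <-]; exists (F u) => //; rewrite /rep_coset.
set v := xget _ _; have Fv : F v = F u.
  by apply: (@xgetPex _ 1 [set v | F v = F u]); exists u.
apply/seteqP; split=> w; rewrite /left_coset /mkset => Hw.
  by have := subgroupM gH (FH _ _ (esym Fv)) Hw; rewrite mulgA mulgK.
by have := subgroupM gH (FH _ _ Fv) Hw; rewrite mulgA mulgK.
Qed.

(** The determinant is a unit of [Z] congruent to 1 mod 4. *)
Lemma det_eq1_mod4 (p q r s p' q' r' s' : int) :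
  (p * p' + q * r')%R = 1%R -> (r * p' + s * r')%R = 0%R ->
  (p * q' + q * s')%R = 0%R -> (r * q' + s * s')%R = 1%R ->
  (4 %| (p - 1)%R)%Z -> (4 %| q)%Z -> (4 %| r)%Z -> (4 %| (s - 1)%R)%Z ->
  (p * s - q * r = 1)%R.
Proof.
move=> pp rp pq rs /dvdzP[a pE] /dvdzP[b qE] _ /dvdzP[c sE].
have det_mul : ((p * s - q * r) * (p' * s' - q' * r') = 1)%R.
  transitivity ((p * p' + q * r') * (r * q' + s * s') -
    (p * q' + q * s') * (r * p' + s * r'))%R; first by ring.
  by rewrite pp rp pq rs; ring.
have /eqP := congr1 absz det_mul.
rewrite abszM muln_eq1 => /andP[/eqP det_abs _].
have detE : (p * s - q * r = 4 * (a * s + c - b * r) + 1)%R.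
  have -> : p = (a * 4 + 1)%R by rewrite -pE subrK.
  have -> : s = (c * 4 + 1)%R by rewrite -sE subrK.
  by rewrite qE; ring.
by move: (a * s + c - b * r)%R detE det_abs => d ->; lia.
Qed.

Lemma congruent4_mx (f : aut Phi) : congruent_id 4 f ->
  let p := (ab (f gen_x)).1 in let r := (ab (f gen_x)).2 in
  let q := (ab (f gen_y)).1 in let s := (ab (f gen_y)).2 in
  [/\ (4 %| (p - 1)%R)%Z, (4 %| q)%Z, (4 %| r)%Z & (4 %| (s - 1)%R)%Z].
Proof.
move=> f1 p r q s.
have /andP[] := f1 (1%R, 0%R); have /andP[] := f1 (0%R, 1%R).
by rewrite /act /= !mulr1 !mulr0 !addr0 !add0r.
Qed.

Lemma congruent4_det (f : aut Phi) : congruent_id 4 f ->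
  ((ab (f gen_x)).1 * (ab (f gen_y)).2 -
   (ab (f gen_y)).1 * (ab (f gen_x)).2 = 1)%R.
Proof.
move=> f1; have [p1 q0 r0 s1] := congruent4_mx f1.
have [px rx] := actVK f (1%R, 0%R); have [qy sy] := actVK f (0%R, 1%R).
exact: det_eq1_mod4 px rx qy sy p1 q0 r0 s1.
Qed.

Local Notation point k := (@Ordinal 5 k isT).

Definition cycle3 (i j k t : 'I_5) : 'I_5 :=
  if t == i then j else if t == j then k else if t == k then i else t.

(** The two 3-cycles generate the alternating group on five points, which is
perfect.  The point 3 is fixed by [alpha], as the label of [(1, 0)] must be. *)
Definition alpha := cycle3 (point 0) (point 1) (point 2).
Definition alpha' := cycle3 (point 2) (point 1) (point 0).
Definition beta := cycle3 (point 2) (point 3) (point 4).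
Definition beta' := cycle3 (point 4) (point 3) (point 2).

Lemma alphaK : cancel alpha alpha'.
Proof. by case=> [[|[|[|[|[|]]]]] i5] //; apply/val_inj. Qed.
Lemma alpha'K : cancel alpha' alpha.
Proof. by case=> [[|[|[|[|[|]]]]] i5] //; apply/val_inj. Qed.
Lemma betaK : cancel beta beta'.
Proof. by case=> [[|[|[|[|[|]]]]] i5] //; apply/val_inj. Qed.
Lemma beta'K : cancel beta' beta.
Proof. by case=> [[|[|[|[|[|]]]]] i5] //; apply/val_inj. Qed.
Lemma alpha_base : alpha (point 3) = point 3.
Proof. exact/val_inj. Qed.

Definition color (v : Z2) : 'I_5 :=
  label alpha alpha' beta beta' (point 3) v.1 v.2.

Definition odd_even_vec (v : Z2) := odd_even v.1 v.2.

Lemma odd_even_vec_eqm4 v w :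
  eqmZ2 4 v w -> odd_even_vec v = odd_even_vec w.
Proof.
case: v w => [i j] [k l]; rewrite /eqmZ2 /odd_even_vec /odd_even /=.
by move=> /andP[]; lia.
Qed.

(** Being trivial mod 4 makes the action preserve the set of colored vectors
and have determinant 1, as [label_unimodular] requires. *)
Definition labelling_stabilizer : set (aut Phi) :=
  [set f | congruent_id 4 f /\
    forall v, odd_even_vec v -> color (act f v) = color v].

Lemma congruent_id_div m f g : congruent_id m f -> congruent_id m g ->
  congruent_id m (f / g).
Proof.
move=> f1 g1 v; rewrite actM; apply: eqmZ2_trans (f1 _) _.
by rewrite eqmZ2_sym -{1}(actVK g v); exact: g1.
Qed.

Lemma subgroup_stabilizer : is_subgroup labelling_stabilizer.
Proof.
split=> [|f g [f1 fl] [g1 gl]].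
  by split=> v; rewrite act1 //; exact: eqmZ2_refl.
split; first exact: congruent_id_div.
move=> v ov; have ou : odd_even_vec (act g^-1 v).
  by rewrite -(odd_even_vec_eqm4 (g1 _)) actVK.
by rewrite actM fl // -[in RHS](actVK g v) gl.
Qed.

Lemma congruent4_recolors f : congruent_id 4 f ->
  exists t : {ffun 'I_5 -> 'I_5},
    forall v, odd_even_vec v -> color (act f v) = t (color v).
Proof.
move=> f1; have [p1 q0 r0 _] := congruent4_mx f1.
have even4 (k : int) : (4 %| k)%Z -> (2 %| k)%Z by lia.
have [t tE] := label_unimodular alphaK alpha'K betaK beta'K alpha_base p1
  (even4 _ q0) (even4 _ r0) (congruent4_det f1).
by exists (finfun t) => v ov; rewrite ffunE; exact: tE.
Qed.

Definition residues4 (f : aut Phi) : 'I_4 * 'I_4 * ('I_4 * 'I_4) :=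
  let res (k : int) : 'I_4 := inord (absz (k %% 4)%Z) in
  (res (ab (f gen_x)).1, res (ab (f gen_x)).2,
   (res (ab (f gen_y)).1, res (ab (f gen_y)).2)).

Lemma inord_res4 (k l : int) :
  inord (absz (k %% 4)%Z) = inord (absz (l %% 4)%Z) :> 'I_4 ->
  (4 %| (k - l)%R)%Z.
Proof. by move/(congr1 (@nat_of_ord 4)); rewrite !inordK; lia. Qed.

Lemma residues4_congruent f g :
  residues4 f = residues4 g -> congruent_id 4 (f^-1 * g).
Proof.
move=> [/inord_res4 p4 /inord_res4 r4 /inord_res4 q4 /inord_res4 s4] v.
rewrite actM -[X in eqmZ2 _ _ X](actK f); apply: eqmZ2_act.
rewrite eqmZ2_sym /eqmZ2 /act /=.
have E (a b c d i j : int) :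
  (a * i + c * j - (b * i + d * j) = (a - b) * i + (c - d) * j)%R by ring.
by rewrite !E; apply/andP; split; apply: rpredD; exact: dvdz_mulr.
Qed.

(** The coset of [f] is determined by two finite invariants: the matrix of [f]
mod 4, which selects a representative [base f], and the permutation [pi f] by
which [(base f)^-1 * f], which is trivial mod 4, acts on the colors. *)
Lemma finite_index_stabilizer : finite_index labelling_stabilizer.
Proof.
pose base f := xget 1 [set g | residues4 g = residues4 f].
have baseP f : residues4 (base f) = residues4 f.
  by apply: (@xgetPex _ 1 [set g | residues4 g = residues4 f]); exists f.
have base_f f := congruent4_recolors (residues4_congruent (baseP f)).
pose pi f := projT1 (cid (base_f f)).
have piP f v : odd_even_vec v ->
    color (act (base f)^-1 (act f v)) = pi f (color v).
  by move=> ov; rewrite -actM; exact: (projT2 (cid (base_f f))).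
apply: (@finite_index_of_invariant _ _ _ (fun f => (residues4 f, pi f)));
  last exact: subgroup_stabilizer.
move=> f g eq_fg.
have [res_fg pi_fg] : residues4 f = residues4 g /\ pi f = pi g.
  by case: eq_fg => *; split=> //; congr pair => //; congr pair.
have base_fg : base f = base g by rewrite /base res_fg.
split; first exact: residues4_congruent.
move=> v ov; pose b := base f.
have s1 : congruent_id 4 (b^-1 * f) := residues4_congruent (baseP f).
have s2 : congruent_id 4 (b^-1 * g).
  by apply: residues4_congruent; rewrite baseP.
have sV : congruent_id 4 (b^-1 * f)^-1.
  by rewrite -[X in congruent_id _ X]mul1g; apply: congruent_id_div => // w;
     rewrite act1; exact: eqmZ2_refl.
have [t tE] := congruent4_recolors sV.
have -> : f^-1 * g = (b^-1 * f)^-1 * (b^-1 * g).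
  by rewrite invgM invgK -mulgA mulVKg.
rewrite actM tE ?(odd_even_vec_eqm4 (s2 v)) // [act _ v]actM.
rewrite /b base_fg piP // -pi_fg -piP //.
by rewrite -actM -tE ?(odd_even_vec_eqm4 (s1 v)) // actK.
Qed.

(** * An automorphism trivial mod m with prescribed action on colors *)

Local Notation recoloring := (('I_5 -> 'I_5) * ('I_5 -> 'I_5))%type.

(** The permutation of the colors induced by [f], given together with that of
its inverse, so that permutations multiply, invert and compute as plain
functions. *)
Definition recolors (f : aut Phi) (s : recoloring) :=
  [/\ forall v, odd_even_vec v -> odd_even_vec (act f v),
     forall v, odd_even_vec v -> odd_even_vec (act f^-1 v),
     forall v, odd_even_vec v -> color (act f v) = s.1 (color v)
   & forall v, odd_even_vec v -> color (act f^-1 v) = s.2 (color v)].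

Definition recoloring_mul (s t : recoloring) : recoloring :=
  (s.1 \o t.1, t.2 \o s.2).
Definition recoloring_inv (s : recoloring) : recoloring := (s.2, s.1).
Definition recoloring_conj s t :=
  recoloring_mul (recoloring_inv t) (recoloring_mul s t).
Definition recoloring_comm s t :=
  recoloring_mul (recoloring_inv s) (recoloring_conj s t).

Lemma recolorsM f g s t :
  recolors f s -> recolors g t -> recolors (f * g) (recoloring_mul s t).
Proof.
move=> [of_ ofV lf lfV] [og ogV lg lgV]; split=> v ov; rewrite ?invgM actM /=.
- by auto.
- by auto.
- by rewrite lf ?lg //; auto.
- by rewrite lgV ?lfV //; auto.
Qed.

Lemma recolorsV f s : recolors f s -> recolors f^-1 (recoloring_inv s).
Proof. by move=> [of_ ofV lf lfV]; split; rewrite ?invgK. Qed.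

Lemma recolorsJ f g s t :
  recolors f s -> recolors g t -> recolors (f ^ g) (recoloring_conj s t).
Proof.
by move=> rf rg; apply: recolorsM; [exact: recolorsV | exact: recolorsM].
Qed.

Lemma recolorsR f g s t :
  recolors f s -> recolors g t -> recolors [~ f, g] (recoloring_comm s t).
Proof.
by move=> rf rg; apply: recolorsM; [exact: recolorsV | exact: recolorsJ].
Qed.

Lemma recolorsX f s n :
  recolors f s -> recolors (f ^+ n) (iter n s.1, iter n s.2).
Proof.
move=> rf; elim: n => [|n IHn].
  by rewrite expg0; split=> v ov; rewrite ?invg1 act1.
have [o oV l lV] := recolorsM rf IHn; rewrite expgS; split=> [|||v ov] //.
by rewrite [RHS]iterSr; exact: lV.
Qed.

Lemma recolors_eq f s t :
  recolors f s -> s.1 =1 t.1 -> s.2 =1 t.2 -> recolors f t.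
Proof.
by move=> [o oV l lV] st1 st2; split=> // v ov; rewrite -?st1 -?st2; auto.
Qed.

Lemma transvection_recolors1 (f : aut Phi) :
  (forall v, act f v = (v.1 + 2 * v.2, v.2)%R) -> recolors f (alpha, alpha').
Proof.
move=> fE; have fVE v : act f^-1 v = (v.1 - 2 * v.2, v.2)%R.
  by rewrite -[RHS](actK f) fE /= subrK -surjective_pairing.
have of_ v : odd_even_vec v -> odd_even_vec (act f v).
  by move=> ov; rewrite fE; have := odd_even_shift1 1 ov; rewrite mulr1.
have ofV v : odd_even_vec v -> odd_even_vec (act f^-1 v).
  move=> ov; rewrite fVE; have := odd_even_shift1 (-1) ov.
  by rewrite mulrN1 mulNr.
have lf v : odd_even_vec v -> color (act f v) = alpha (color v).
  move=> ov; rewrite fE; exact: (label_shift1 _ _ alpha'K alpha_base).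
split=> //= v ov.
by rewrite -[v in RHS](actVK f) lf ?alphaK //; exact: ofV.
Qed.

Lemma transvection_recolors2 (f : aut Phi) :
  (forall v, act f v = (v.1, v.2 + 2 * v.1)%R) -> recolors f (beta, beta').
Proof.
move=> fE; have fVE v : act f^-1 v = (v.1, v.2 - 2 * v.1)%R.
  by rewrite -[RHS](actK f) fE /= subrK -surjective_pairing.
have of_ v : odd_even_vec v -> odd_even_vec (act f v).
  by move=> ov; rewrite fE; have := odd_even_shift2 1 ov; rewrite mulr1.
have ofV v : odd_even_vec v -> odd_even_vec (act f^-1 v).
  move=> ov; rewrite fVE; have := odd_even_shift2 (-1) ov.
  by rewrite mulrN1 mulNr.
have lf v : odd_even_vec v -> color (act f v) = beta (color v).
  move=> ov; rewrite fE; exact: (label_shift2 _ _ _ beta'K).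
split=> //= v ov.
by rewrite -[v in RHS](actVK f) lf ?betaK //; exact: ofV.
Qed.

(** Choose [t] divisible by the 2-part of [6 m] and congruent to 1 modulo
its odd part.  Then [t] is idempotent mod [m], it is even, and it is 1 mod 3,
whence [e = t / 2] is 2 mod 3. *)
Lemma idempotent_mod (m : nat) : (0 < m)%N -> exists e : nat,
  (e %% 3 = 2)%N /\ (m%:Z %| ((2 * e%:Z) * (2 * e%:Z) - 2 * e%:Z)%R)%Z.
Proof.
move=> m_gt0; pose n := (6 * m)%N.
have n_gt0 : (0 < n)%N by lia.
pose P := (n`_2)%N; pose Q := (n`_2^')%N.
have PQ : (P * Q = n)%N by exact: partnC.
have coPQ : coprime P Q by exact: coprime_partC.
pose t := chinese P Q 0 1.
have tP : (P %| t)%N by rewrite /dvdn chinese_modl // mod0n.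
have tQ : t = 1 %[mod Q] by exact: chinese_modr.
have P2 : (2 %| P)%N.
  have <- : (2`_2 = 2)%N by exact: part_pnat_id.
  by apply: partn_dvd => //; apply: dvdn_mulr.
have Q3 : (3 %| Q)%N.
  have <- : (3`_2^' = 3)%N by exact: part_pnat_id.
  by apply: partn_dvd => //; apply: dvdn_mulr.
have t3 : (t %% 3 = 1)%N by rewrite -(modn_dvdm t Q3) tQ modn_dvdm.
have tQ1 : (Q%:Z %| t%:Z - 1)%Z.
  by rewrite -eqz_mod_dvd !modz_nat tQ.
have tt : (n%:Z %| (t%:Z * (t%:Z - 1))%R)%Z.
  by rewrite -PQ PoszM; apply: dvdz_mul.
have t2 : (2 %| t)%N := dvdn_trans P2 tP.
have [e tE] := dvdnP t2.
exists e; split; first by move: t3; rewrite tE; clear; lia.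
have -> : (2 * e%:Z * (2 * e%:Z) - 2 * e%:Z = t%:Z * (t%:Z - 1))%R.
  by rewrite tE PoszM; ring.
by apply: dvdz_trans tt; rewrite /n PoszM; exact: dvdz_mull.
Qed.

(** The product [(1 t; 0 1) (1 0; -t 1) (1 t; 0 1)] with [t = 2 e], which is the
quarter turn [(0 1; -1 0)] when [t = 1]. *)
Definition quarter (f g : aut Phi) (e : nat) := f ^+ e * (g ^- e * f ^+ e).

Section Quarter.
Variables (f g : aut Phi) (e m : nat).
Hypothesis fE : forall v, act f v = (v.1 + 2 * v.2, v.2)%R.
Hypothesis gE : forall v, act g v = (v.1, v.2 + 2 * v.1)%R.
Local Notation t := (2 * e%:Z)%R.
Hypothesis idem_t : (m%:Z %| (t * t - t)%R)%Z.

Lemma transvectionX1 n v : act (f ^+ n) v = (v.1 + 2 * n%:Z * v.2, v.2)%R.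
Proof.
elim: n => [|n IHn].
  by rewrite expg0 act1 mulr0 mul0r addr0 -surjective_pairing.
by rewrite expgS actM IHn fE /=; congr pair; lia.
Qed.

Lemma transvectionX2 n v : act (g ^+ n) v = (v.1, v.2 + 2 * n%:Z * v.1)%R.
Proof.
elim: n => [|n IHn].
  by rewrite expg0 act1 mulr0 mul0r addr0 -surjective_pairing.
by rewrite expgS actM IHn gE /=; congr pair; lia.
Qed.

Lemma transvectionXV2 n v : act (g ^- n) v = (v.1, v.2 - 2 * n%:Z * v.1)%R.
Proof.
by rewrite -[RHS](actK (g ^+ n)) transvectionX2 /= subrK -surjective_pairing.
Qed.

(** Modulo [t^2 = t] the product is [(1 - t) 1 + t J], where [J] is the quarter
turn.  As [t] and [1 - t] are orthogonal idempotents, its powers are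
[(1 - t) 1 + t J^k]; the square is [1 - 2 t] and the fourth power is 1. *)
Lemma quarter_mod v : eqmZ2 m (act (quarter f g e) v)
  ((1 - t) * v.1 + t * v.2, (1 - t) * v.2 - t * v.1)%R.
Proof.
rewrite !actM transvectionX1 transvectionXV2 transvectionX1 /eqmZ2 /=.
have -> : (v.1 + t * v.2 + t * (v.2 - t * (v.1 + t * v.2)) -
   ((1 - t) * v.1 + t * v.2) = - (v.1 + (t + 1) * v.2) * (t * t - t))%R by ring.
have -> : (v.2 - t * (v.1 + t * v.2) - ((1 - t) * v.2 - t * v.1) =
  - v.2 * (t * t - t))%R by ring.
by rewrite !dvdz_mull.
Qed.

Lemma quarter_sqr_mod v : eqmZ2 m (act (quarter f g e ^+ 2) v)
  ((1 - 2 * t) * v.1, (1 - 2 * t) * v.2)%R.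
Proof.
rewrite expg2 actM; apply: eqmZ2_trans (eqmZ2_act _ (quarter_mod v)) _.
apply: eqmZ2_trans (quarter_mod _) _; rewrite /eqmZ2 /=.
have -> : ((1 - t) * ((1 - t) * v.1 + t * v.2) + t * ((1 - t) * v.2 - t * v.1)
   - (1 - 2 * t) * v.1 = - 2 * v.2 * (t * t - t))%R by ring.
have -> : ((1 - t) * ((1 - t) * v.2 - t * v.1) - t * ((1 - t) * v.1 + t * v.2)
   - (1 - 2 * t) * v.2 = 2 * v.1 * (t * t - t))%R by ring.
by rewrite !dvdz_mull.
Qed.

Lemma quarter_congruent : congruent_id m (quarter f g e ^+ 4).
Proof.
move=> v; rewrite -[4%N]/(2 + 2)%N expgnDr actM.
apply: eqmZ2_trans (eqmZ2_act _ (quarter_sqr_mod v)) _.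
apply: eqmZ2_trans (quarter_sqr_mod _) _; rewrite /eqmZ2 /=.
have E (k : int) :
  ((1 - 2 * t) * ((1 - 2 * t) * k) - k = 4 * k * (t * t - t))%R by ring.
by rewrite !E !dvdz_mull.
Qed.

End Quarter.

Lemma iter_order3 (T : Type) (p : T -> T) e : (forall x, p (p (p x)) = x) ->
  (e %% 3 = 2)%N -> iter e p =1 p \o p.
Proof.
move=> p3 e2 x; rewrite (divn_eq e 3) e2 addnC iterD /=.
by elim: (e %/ 3)%N => // n IHn; rewrite mulSn iterD /= p3 IHn.
Qed.

Theorem theorem1p1 : ~ has_CSP (free_metabelian 'I_2).
Proof.
move=> csp.
have [K [finK KH]] := csp _ subgroup_stabilizer finite_index_stabilizer.
have gK := (char_setP K).1.
have [mx mx_gt0 Kx] := exponent_of_finite_index gen_x gK finK.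
have [my my_gt0 Ky] := exponent_of_finite_index gen_y gK finK.
pose m := (mx * my)%N.
have KX u k n : char_set K (u ^+ k) -> char_set K (u ^+ (k * n)).
  move=> Ku; rewrite expgnA; elim: n => [|n IHn]; first by exact: gK.1.
  by rewrite expgS; exact: subgroupM.
have m_gt0 : (0 < m)%N by rewrite muln_gt0 mx_gt0.
have [e [e2 idem_e]] := idempotent_mod m_gt0.
have [f fE] := transvection1; have [g gE] := transvection2.
pose w := quarter f g e ^+ 4.
have w1 : congruent_id m w := quarter_congruent fE gE idem_e.
pose z := [~ [~ w, w ^ f], [~ w, w ^ g]].
have Kz : congruence_subgroup K z.
  apply: (second_derived_congruence m_gt0) => //; try exact: congruent_idJ.
    by exact: KX.
  by rewrite /m mulnC; exact: KX.
have [_ z_color] := KH _ Kz.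
have rf := transvection_recolors1 fE; have rg := transvection_recolors2 gE.
pose a2 := (alpha \o alpha, alpha' \o alpha').
pose b2 := (beta \o beta, beta' \o beta').
have rfe : recolors (f ^+ e) a2.
  by apply: recolors_eq (recolorsX e rf) _ _; apply: iter_order3 => //;
    case=> [[|[|[|[|[|]]]]] i5] //; apply/val_inj.
have rge : recolors (g ^+ e) b2.
  by apply: recolors_eq (recolorsX e rg) _ _; apply: iter_order3 => //;
    case=> [[|[|[|[|[|]]]]] i5] //; apply/val_inj.
(* As [e] is 2 mod 3, the permutation of [w] does not depend on [e]. *)
have rq := recolorsM rfe (recolorsM (recolorsV rge) rfe).
have rw : recolors w _ := recolorsX 4 rq.
have [_ _ rz _] : recolors z _ :=
  recolorsR (recolorsR rw (recolorsJ rw rf)) (recolorsR rw (recolorsJ rw rg)).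
have ov1 : odd_even_vec (1%R, 0%R) by [].
have color1 : color (1%R, 0%R) = point 3 by exact: label_unfold.
have := rz _ ov1; rewrite (z_color _ ov1) color1.
(* The 5-cycle of [z] moves the color 3 to another one. *)
by move/(congr1 (@nat_of_ord 5)); vm_compute.
Qed.
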